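(* Let $n\ge 1$, $D=[0,1]^n$, and let $\Omega:\mathbb{R}^n_+\to\mathbb{R}$ be an arbitrary MC-type function that is concave in each variable. Then for every $\mathbf{m}=(m_1,\dots,m_n)\in\mathbb{N}^n$ with $m_i\ge 2$ for $i=1,\dots,n$, $$E_{\mathbf{m}}\left(C_D(\Omega)\right)=\Omega\left(\frac{1}{2m_1},\dots,\frac{1}{2m_n}\right),$$ where $E_{\mathbf{m}}(C_D(\Omega))=\sup\{\max_{\mathbf{x}\in D}|f(\mathbf{x})-S_{\mathbf{m}}(f;\mathbf{x})| : f\in C_D(\Omega)\}$.
   Context: Notation: $\mathbb{R}^n_+=\{\mathbf{x}\in\mathbb{R}^n: x_i\ge 0,\ i=1,\dots,n\}$. MC-type function: a function $\Omega$ on $\mathbb{R}^n_+$ such that (1) $\Omega(\mathbf{0})=0$; (2) $\Omega$ is non-decreasing (with respect to the coordinatewise order, i.e. in each variable); (3) $\Omega(\boldsymbol\tau+\boldsymbol\gamma)\le\Omega(\boldsymbol\tau)+\Omega(\boldsymbol\gamma)$ for all $\boldsymbol\tau,\boldsymbol\gamma\in\mathbb{R}^n_+$; (4) $\Omega$ is continuous. Total modulus of continuity: for bounded $f$ on $D=[0,1]^n$ and $\boldsymbol\tau$ with $0\le\tau_i\le 1$, $$\omega(f;\boldsymbol\tau)=\sup\{|f(\mathbf{x})-f(\mathbf{y})| : \mathbf{x},\mathbf{y}\in D,\ |x_i-y_i|\le\tau_i,\ i=1,\dots,n\}.$$ Class $C_D(\Omega)$: all continuous $f:D\to\mathbb{R}$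 with $\omega(f;\boldsymbol\tau)\le\Omega(\boldsymbol\tau)$ for all $\boldsymbol\tau$ with $0\le\tau_i\le1$, $i=1,\dots,n$. Interpolating multilinear spline: given $\mathbf{m}\in\mathbb{N}^n$, the nodes are $\mathbf{x}^{\mathbf{j}}=(j_1/m_1,\dots,j_n/m_n)$, $j_i\in\{0,\dots,m_i\}$. For continuous $f$ on $D$, $S_{\mathbf{m}}(f;\cdot)$ is the function on $D$ which on every block $D_{\mathbf{j}}=\prod_{i=1}^n[\frac{j_i}{m_i},\frac{j_i+1}{m_i}]$, $j_i\in\{0,\dots,m_i-1\}$, is a polynomial of degree at most one in each variable $x_i$ separately, and which satisfies $S_{\mathbf{m}}(f;\mathbf{x}^{\mathbf{j}})=f(\mathbf{x}^{\mathbf{j}})$ at all nodes. Explicitly, for $\mathbf{x}\in D_{\mathbf{j}}$, $$S_{\mathbf{m}}(f;\mathbf{x})=\sum_{\mathbf{l}\in\{0,1\}^n} f(\mathbf{x}^{\mathbf{j}+\mathbf{l}})\prod_{i=1}^n H_{l_i,j_i}(x_i),\quad H_{0,j_i}(x_i)=m_i\left(\tfrac{j_i+1}{m_i}-x_i\right),\quad H_{1,j_i}(x_i)=1-H_{0,j_i}(x_i).$$ *)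

(* Defs.v *)
From HB Require Import structures.
From mathcomp Require Import all_boot all_order all_algebra.
From mathcomp Require Import all_classical all_reals all_analysis.
From mathcomp Require Import ring lra zify.

Set Implicit Arguments.
Unset Strict Implicit.
Unset Printing Implicit Defensive.

Import Order.TTheory GRing.Theory Num.Theory.
Import numFieldNormedType.Exports.

Local Open Scope classical_set_scope.
Local Open Scope ring_scope.

Definition orthant (R : realType) (n : nat) : set 'rV[R]_n :=
  [set x | forall i, 0 <= x 0 i].

Definition cube (R : realType) (n : nat) : set 'rV[R]_n :=
  [set x | forall i, 0 <= x 0 i <= 1].

(* Functions on the orthant (or on the cube) are total functions on 'rV[R]_n
   of which only the restriction to the orthant (or to the cube) matters. *)
Record MC_type (R : realType) (n : nat) (Omega : 'rV[R]_n -> R) : Prop := {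
  MC_zero : Omega 0 = 0;
  MC_nondecreasing : forall s t, @orthant R n s -> @orthant R n t ->
    (forall i, s 0 i <= t 0 i) -> Omega s <= Omega t;
  MC_subadditive : forall s t, @orthant R n s -> @orthant R n t ->
    Omega (s + t) <= Omega s + Omega t;
  MC_continuous : {within @orthant R n, continuous Omega}
}.

Definition set_coord (R : realType) (n : nat) (x : 'rV[R]_n) (i : 'I_n)
    (t : R) : 'rV[R]_n :=
  \row_j (if j == i then t else x 0 j).

Definition concave_in_each_variable (R : realType) (n : nat)
    (Omega : 'rV[R]_n -> R) : Prop :=
  forall (x : 'rV[R]_n) (i : 'I_n), orthant x ->
    @convex_function R R^o [set t | 0 <= t]
      (fun t => - Omega (set_coord x i t)).

(* Suprema are taken in \bar R, so that they are meaningful before being known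
   to be finite. *)
Definition total_modulus (R : realType) (n : nat) (f : 'rV[R]_n -> R)
    (tau : 'rV[R]_n) : \bar R :=
  ereal_sup [set `|f z.1 - f z.2|%:E | z in
    [set z : 'rV[R]_n * 'rV[R]_n | [/\ cube z.1, cube z.2 &
      forall i, `|z.1 0 i - z.2 0 i| <= tau 0 i]]].

Definition class_C (R : realType) (n : nat) (Omega : 'rV[R]_n -> R) :
    set ('rV[R]_n -> R) :=
  [set f | {within @cube R n, continuous f} /\
    forall tau, cube tau -> (total_modulus f tau <= (Omega tau)%:E)%E].

Definition node (R : realType) (n : nat) (m j : 'I_n -> nat) : 'rV[R]_n :=
  \row_i ((j i)%:R / (m i)%:R).

Definition block (R : realType) (n : nat) (m j : 'I_n -> nat) :
    set 'rV[R]_n :=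
  [set x | forall i, (j i)%:R / (m i)%:R <= x 0 i <= (j i).+1%:R / (m i)%:R].

Definition H (R : realType) (l : bool) (m j : nat) (t : R) : R :=
  let H0 := m%:R * (j.+1%:R / m%:R - t) in if l then 1 - H0 else H0.

Definition block_interpolant (R : realType) (n : nat) (m j : 'I_n -> nat)
    (f : 'rV[R]_n -> R) (x : 'rV[R]_n) : R :=
  \sum_(l : {ffun 'I_n -> bool})
    f (node R m (fun i => (j i + l i)%N)) *
    \prod_(i < n) H (l i) (m i) (j i) (x 0 i).

(* A point on a common face of several blocks is assigned to the block of
   largest index; by spline_blockE below the choice is immaterial. *)
Definition block_index (R : realType) (n : nat) (m : 'I_n -> nat)
    (x : 'rV[R]_n) (i : 'I_n) : nat :=
  minn (Num.truncn ((m i)%:R * x 0 i)) (m i).-1.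

Definition spline (R : realType) (n : nat) (m : 'I_n -> nat)
    (f : 'rV[R]_n -> R) (x : 'rV[R]_n) : R :=
  block_interpolant m (block_index m x) f x.

(* For continuous f this supremum is a maximum, see deviation_attained. *)
Definition deviation (R : realType) (n : nat) (m : 'I_n -> nat)
    (f : 'rV[R]_n -> R) : \bar R :=
  ereal_sup [set `|f x - spline m f x|%:E | x in @cube R n].

Definition interpolation_error (R : realType) (n : nat) (m : 'I_n -> nat)
    (F : set ('rV[R]_n -> R)) : \bar R :=
  ereal_sup [set deviation m f | f in F].

Lemma block_indexP (R : realType) (n : nat) (m : 'I_n -> nat)
    (x : 'rV[R]_n) : (forall i, (0 < m i)%N) -> cube x ->
  (forall i, (block_index m x i < m i)%N) /\ block m (block_index m x) x.
Proof.
move=> m0 Dx; split=> [i|i]; first by rewrite /block_index; have := m0 i; lia.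
have mi0 : 0 < (m i)%:R :> R by rewrite ltr0n m0.
have /andP[x0 x1] := Dx i.
have mx0 : 0 <= (m i)%:R * x 0 i by rewrite mulr_ge0// ltW.
have /andP[h1 h2] := truncn_itv mx0.
rewrite ler_pdivrMr// ler_pdivlMr// [x 0 i * _]mulrC /block_index.
set k := Num.truncn _ in h1 h2 *.
have [kle|kgt] := leqP k (m i).-1; first by rewrite h1 ltW.
rewrite prednK ?m0//; apply/andP; split; last by rewrite ler_piMr// ltW.
by apply: le_trans h1; rewrite ler_nat ltnW.
Qed.

Lemma block_interpolant_eq (R : realType) (n : nat) (m j k : 'I_n -> nat)
    (f : 'rV[R]_n -> R) (x : 'rV[R]_n) : (forall i, (0 < m i)%N) ->
  block m j x -> block m k x ->
  block_interpolant m j f x = block_interpolant m k f x.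
Proof.
move=> m0 xj xk; rewrite /block_interpolant.
have mi0 i : (m i)%:R != 0 :> R by rewrite pnatr_eq0 -lt0n m0.
have mp i : 0 < (m i)%:R :> R by rewrite ltr0n m0.
pose h (l : {ffun 'I_n -> bool}) := [ffun i => l i (+) (j i != k i)].
have hK : involutive h.
  by move=> l; apply/ffunP => i; rewrite !ffunE -addbA addbb addbF.
have key i : [\/ j i = k i,
    k i = (j i).+1 /\ (m i)%:R * x 0 i = (k i)%:R |
    j i = (k i).+1 /\ (m i)%:R * x 0 i = (j i)%:R].
  have := xj i; have := xk i.
  rewrite !ler_pdivrMr// !ler_pdivlMr// [x 0 i * _]mulrC.
  move=> /andP[a1 a2] /andP[b1 b2].
  have kj : (k i <= (j i).+1)%N by rewrite -(ler_nat R) (le_trans a1).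
  have jk : (j i <= (k i).+1)%N by rewrite -(ler_nat R) (le_trans b1).
  have [e|[e|e]] : j i = k i \/ (k i = (j i).+1 \/ j i = (k i).+1) by lia.
  - by constructor 1.
  - constructor 2; split=> //; apply/le_anti; rewrite a1 andbT.
    by rewrite e.
  - constructor 3; split=> //; apply/le_anti; rewrite b1 andbT.
    by rewrite e.
have HE l i : H (h l i) (m i) (j i) (x 0 i) = H (l i) (m i) (k i) (x 0 i).
  rewrite ffunE /H !mulrBr !mulrA ![(m i)%:R * _ / _]mulrC !mulrA !mulVf// !mul1r.
  case: (key i) => [->|[e ->]|[e ->]]; first by rewrite eqxx addbF.
  - have -> : (j i != k i) by apply/eqP; lia.
    by rewrite addbT e; case: (l i) => /=; rewrite -!natr1; ring.
  - have -> : (j i != k i) by apply/eqP; lia.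
    by rewrite addbT e; case: (l i) => /=; rewrite -!natr1; ring.
rewrite (reindex_inj (inv_inj hK)); apply: eq_bigr => l _.
rewrite (eq_bigr _ (fun i _ => HE l i)).
have [/eqP->|P0] := boolP (\prod_(i < n) H (l i) (m i) (k i) (x 0 i) == 0).
  by rewrite !mulr0.
congr (f _ * _); apply/rowP => i; rewrite !mxE; congr (_%:R / _).
have {P0} : H (l i) (m i) (k i) (x 0 i) != 0.
  by move/prodf_neq0 : P0; apply.
rewrite ffunE /H !mulrBr !mulrA ![(m i)%:R * _ / _]mulrC !mulrA !mulVf// !mul1r.
case: (key i) => [->|[e ->]|[e ->]]; first by rewrite eqxx addbF.
- have -> : (j i != k i) by apply/eqP; lia.
  case: (l i) => /=; last by rewrite e addn1 addn0.
  by move=> /eqP[]; rewrite -natr1; ring.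
- have -> : (j i != k i) by apply/eqP; lia.
  case: (l i) => /=; first by rewrite e addn1 addn0.
  by rewrite e subrr eqxx.
Qed.

Lemma spline_blockE (R : realType) (n : nat) (m j : 'I_n -> nat)
    (f : 'rV[R]_n -> R) (x : 'rV[R]_n) : (forall i, (0 < m i)%N) ->
  (forall i, (j i < m i)%N) -> block m j x ->
  spline m f x = block_interpolant m j f x.
Proof.
move=> m0 jm xj; apply: block_interpolant_eq => //.
apply: (block_indexP m0 _).2 => i.
have mp : 0 < (m i)%:R :> R by rewrite ltr0n m0.
have /andP[h1 h2] := xj i; apply/andP; split.
  by apply: le_trans h1; rewrite divr_ge0.
by apply: (le_trans h2); rewrite ler_pdivrMr// mul1r ler_nat jm.
Qed.

Lemma spline_node (R : realType) (n : nat) (m j : 'I_n -> nat)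
    (f : 'rV[R]_n -> R) : (forall i, (0 < m i)%N) ->
  (forall i, (j i <= m i)%N) ->
  spline m f (node R m j) = f (node R m j).
Proof.
move=> m0 jm.
have mi0 i : (m i)%:R != 0 :> R by rewrite pnatr_eq0 -lt0n m0.
pose k i := minn (j i) (m i).-1.
pose b : {ffun 'I_n -> bool} := [ffun i => (j i == m i)].
have jkb i : j i = (k i + b i)%N.
  by rewrite ffunE /k; have := jm i; have := m0 i; case: eqP => /=; lia.
have HE l i : H (l i) (m i) (k i) (node R m j 0 i) = (l i == b i)%:R.
  rewrite mxE /H !mulrBr !mulrA ![(m i)%:R * _ / _]mulrC !mulrA !mulVf// !mul1r.
  by rewrite jkb; case: (l i); case: (b i); rewrite /= -natr1 natrD/=; ring.
rewrite (@spline_blockE _ _ _ k)//.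
- rewrite /block_interpolant (bigD1 b)//=.
  have -> : \prod_(i < n) H (b i) (m i) (k i) (node R m j 0 i) = 1.
    by apply: big1 => i _; rewrite HE eqxx.
  rewrite mulr1 [X in _ + X]big1 => [|l /eqP lb].
    rewrite addr0; congr f; apply/rowP => i.
    by rewrite !mxE -jkb.
  have [i /negPf li] : exists i, l i != b i.
    apply/existsP; rewrite -negb_forall; apply/negP => /forallP e.
    by apply: lb; apply/ffunP => i; exact/eqP.
  by rewrite (bigD1 i)//= HE li mul0r mulr0.
- by move=> i; rewrite /k; have := m0 i; lia.
- move=> i; have mp : 0 < (m i)%:R :> R by rewrite ltr0n m0.
  rewrite !mxE !ler_pM2r ?invr_gt0// !ler_nat /k.
  by have := m0 i; have := jm i; lia.
Qed.

Lemma block_interpolant_continuous (R : realType) (n : nat)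
    (m j : 'I_n -> nat) (f : 'rV[R]_n -> R) :
  continuous (block_interpolant m j f).
Proof.
have cH i l : continuous (fun x : 'rV[R]_n => H l (m i) (j i) (x 0 i)).
  have cc (c : R) : continuous (fun _ : 'rV[R]_n => c) by exact: cst_continuous.
  have ch : continuous (fun y : 'rV[R]_n =>
      (m i)%:R * ((j i).+1%:R / (m i)%:R - y 0 i)).
    move=> x; apply: (@continuousM _ _ (fun=> _)
      (fun y : 'rV[R]_n => (j i).+1%:R / (m i)%:R - y 0 i)); first exact: cc.
    apply: (@continuousB _ _ _ (fun=> _) (fun y : 'rV[R]_n => y 0 i)).
      exact: cc.
    exact: coord_continuous.
  by rewrite /H; case: l => [x|//]; exact: (continuousB (@cc 1 x) (@ch x)).
apply: (@continuous_big _ _ _ _ _ add_continuous) => l _ x.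
apply: (@continuousM _ _ (fun=> _)); first exact: cst_continuous.
by apply: (@continuous_big _ _ _ _ _ mul_continuous) => i _; exact: cH.
Qed.

Lemma deviation_attained (R : realType) (n : nat) (m : 'I_n -> nat)
    (f : 'rV[R]_n -> R) : (forall i, (0 < m i)%N) ->
  {within @cube R n, continuous f} ->
  exists2 x, cube x & deviation m f = `|f x - spline m f x|%:E.
Proof.
move=> m0 cf; set g := fun x => `|f x - spline m f x|.
have mp i : 0 < (m i)%:R :> R by rewrite ltr0n m0.
pose M := (\max_i m i)%N.
have mM i : (m i <= M)%N by rewrite /M leq_bigmax.
pose J := {ffun 'I_n -> 'I_M.+1}.
pose ok (j : J) := [forall i, (j i < m i)%N].
pose B (j : J) := block m (fun i => j i : nat) : set 'rV[R]_n.
have BD j : ok j -> B j `<=` @cube R n.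
  move=> /forallP jm x xj i; have /andP[h1 h2] := xj i; apply/andP; split.
    by apply: le_trans h1; rewrite divr_ge0.
  by apply: (le_trans h2); rewrite ler_pdivrMr// mul1r ler_nat jm.
have maxB j : ok j -> exists2 c, B j c & forall x, B j x -> g x <= g c.
  move=> okj; have /forallP jm := okj.
  have Bcpt : compact (B j).
    apply: (@rV_compact _ _ (fun i => [set t : R |
      (j i)%:R / (m i)%:R <= t <= (j i).+1%:R / (m i)%:R])) => i.
    have := @segment_compact R ((j i)%:R / (m i)%:R) ((j i).+1%:R / (m i)%:R).
    by congr compact; apply/seteqP; split=> t /=; rewrite in_itv.
  have B0 : B j !=set0.
    exists (node R m (fun i => j i : nat)) => i.
    by rewrite mxE lexx ler_pM2r ?invr_gt0// ler_nat leqnSn.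
  have cg : {within B j, continuous
      (fun x => `|f x - block_interpolant m (fun i => j i : nat) f x|)}.
    move=> x; apply: cvg_norm; apply: cvgB.
      exact: (continuous_subspaceW (BD j okj) cf).
    apply: continuous_subspaceT; exact: block_interpolant_continuous.
  have [c cB cmax] := EVT_max_rV B0 Bcpt cg.
  rewrite inE in cB; exists c => // x xB.
  by rewrite /g !(@spline_blockE _ _ _ (fun i => j i : nat))//; apply/cmax/mem_set.
have okj0 : ok [ffun=> ord0] by apply/forallP => i; rewrite ffunE.
pose c j := if pselect (ok j) is left okj then sval (cid2 (maxB j okj)) else 0.
have cP j : ok j -> B j (c j) /\ forall x, B j x -> g x <= g (c j).
  by rewrite /c => okj; case: pselect => // okj'; case: cid2.
have [j okj jmax] := @arg_maxP _ _ _ _ ok (fun j => g (c j)) okj0.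
exists (c j); first exact: BD okj _ (cP j okj).1.
apply/le_anti; apply/andP; split; last first.
  by apply: ereal_sup_ubound; exists (c j) => //; exact: BD okj _ (cP j okj).1.
apply: ge_ereal_sup => _ [x Dx <-]; rewrite lee_fin.
have [km xk] := block_indexP m0 Dx.
pose k : J := [ffun i => inord (block_index m x i)].
have kE i : k i = block_index m x i :> nat.
  by rewrite ffunE inordK// (leq_trans (km i))// leqW.
have okk : ok k by apply/forallP => i; rewrite kE.
apply: le_trans (jmax k okk); apply: (cP k okk).2 => i.
by rewrite !kE.
Qed.

(* Main.v *)
(* Upper bound: on a block, S_m(f; x) is the expectation of f at a random
   vertex with independent coordinates, so |f(x) - S_m(f; x)| is at most the
   expectation of Omega at the random vector of coordinate distances from x to
   the vertex.  Jensen's inequality in one coordinate at a time bounds this by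
   Omega at the vector with entries 2 m_i a_i b_i, where a_i + b_i = 1 / m_i
   are the distances from x_i to the two neighbouring nodes, and
   4 a_i b_i <= (a_i + b_i) ^ 2.
   Lower bound: the composition of Omega with the tent functions of height
   1 / (2 m_i) supported on [0, 1 / m_i] belongs to the class, vanishes at all
   nodes, and takes the required value at the centre of the first block. *)
Require Import Defs.
From mathcomp Require Import all_boot all_order all_algebra.
From mathcomp Require Import all_classical all_reals all_analysis.
From mathcomp Require Import ring lra zify.

Import Order.TTheory GRing.Theory Num.Theory.
Import numFieldNormedType.Exports.

Local Open Scope classical_set_scope.
Local Open Scope ring_scope.

(** * Jensen's inequality for separately concave functions *)

Lemma concave_in_each_variable_conv (R : realType) (n : nat)
    (Omega : 'rV[R]_n -> R) (x : 'rV[R]_n) (i : 'I_n) (w a b : R) :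
  concave_in_each_variable Omega -> orthant x ->
  0 <= w <= 1 -> 0 <= a -> 0 <= b ->
  w * Omega (set_coord x i a) + (1 - w) * Omega (set_coord x i b) <=
  Omega (set_coord x i (w * a + (1 - w) * b)).
Proof.
move=> Oc x0 /andP[w0 w1] a0 b0.
have wi : Itv.spec (@Itv.num_sem R) (Itv.Real `[0%Z, 1%Z]) w.
  by apply/andP; split; [exact: num_real|rewrite /= in_itv/= w0 w1].
have := Oc x i x0 (Itv.mk wi) a b (mem_set a0) (mem_set b0).
by rewrite !convRE /unstable.onem /=; lra.
Qed.

(** Expands the product of the factors [w i + (1 - w i)]: the total mass of independent Bernoulli
    variables. *)
Lemma sum_prod_bool (R : realType) (n : nat) (w : 'I_n -> R) :
  \sum_(l : {ffun 'I_n -> bool})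
    \prod_(i < n) (if l i then w i else 1 - w i) = 1.
Proof.
rewrite -(bigA_distr_bigA (fun i (c : bool) => if c then w i else 1 - w i)).
by apply: big1 => i _; rewrite big_bool /= addrC subrK.
Qed.

Lemma multilinear_jensen (R : realType) (n : nat) (Omega : 'rV[R]_n -> R)
    (w a b : 'I_n -> R) :
  concave_in_each_variable Omega ->
  (forall i, 0 <= w i <= 1) -> (forall i, 0 <= a i) -> (forall i, 0 <= b i) ->
  \sum_(l : {ffun 'I_n -> bool})
    Omega (\row_i (if l i then a i else b i)) *
    \prod_(i < n) (if l i then w i else 1 - w i) <=
  Omega (\row_i (w i * a i + (1 - w i) * b i)).
Proof.
move=> Oc w01 a0 b0.
pose c i := w i * a i + (1 - w i) * b i.
(* In [p k l] the first [k] coordinates of the vertex [l] are already averaged, so [T] passes from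
   the left-hand side at [0] to the right-hand side at [n]. *)
pose p k (l : {ffun 'I_n -> bool}) : 'rV[R]_n :=
  \row_i (if (i < k)%N then c i else if l i then a i else b i).
pose W (l : {ffun 'I_n -> bool}) :=
  \prod_(i < n) (if l i then w i else 1 - w i).
pose T k := \sum_l Omega (p k l) * W l.
have c0 i : 0 <= c i.
  have /andP[w0 w1] := w01 i.
  by rewrite addr_ge0 ?mulr_ge0 ?subr_ge0.
have Tn : T n = Omega (\row_i c i).
  rewrite /T (eq_bigr (fun l => Omega (\row_i c i) * W l)) => [|l _].
    by rewrite -mulr_sumr sum_prod_bool mulr1.
  by congr (Omega _ * _); apply/rowP => i; rewrite !mxE ltn_ord.
have T0 : T 0%N = \sum_(l : {ffun 'I_n -> bool})
    Omega (\row_i (if l i then a i else b i)) * W l by [].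
rewrite -/(T 0%N) -Tn {Tn T0}.
suff step k : (k < n)%N -> T k <= T k.+1.
  suff H k : (k <= n)%N -> T 0%N <= T k by exact: H.
  by elim: k => // k IH kn; apply: le_trans (IH (ltnW kn)) (step _ kn).
move=> kn; pose i0 := Ordinal kn.
(* Averaging over the flip of coordinate [k] reduces to a convex combination
   in that coordinate alone. *)
pose h (l : {ffun 'I_n -> bool}) := [ffun i => l i (+) (i == i0)].
have hK : involutive h.
  by move=> l; apply/ffunP => i; rewrite !ffunE -addbA addbb addbF.
(* Adding the sum to its reindexing by [h] avoids choosing a representative of each pair [l],
   [h l]. *)
have double k' :
    T k' + T k' = \sum_l (Omega (p k' l) * W l + Omega (p k' (h l)) * W (h l)).
  by rewrite big_split; congr (_ + _); exact: (reindex_inj (inv_inj hK)).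
suff : T k + T k <= T k.+1 + T k.+1 by lra.
rewrite !double; apply: ler_sum => l _.
pose W' := \prod_(i < n | i != i0) (if l i then w i else 1 - w i).
have W'0 : 0 <= W'.
  apply: prodr_ge0 => i _; have /andP[w0 w1] := w01 i.
  by case: (l i) => //; rewrite subr_ge0.
have WE : W l = (if l i0 then w i0 else 1 - w i0) * W'.
  by rewrite /W (bigD1 i0).
have WhE : W (h l) = (if l i0 then 1 - w i0 else w i0) * W'.
  rewrite /W (bigD1 i0)//= ffunE eqxx addbT; congr (_ * _).
    by case: (l i0).
  by apply: eq_bigr => i /negPf ii0; rewrite ffunE ii0 addbF.
have p0 : orthant (p k l).
  by move=> i; rewrite mxE; case: ifP => // _; case: (l i).
have pk1 l' : (l' = l \/ l' = h l) -> p k.+1 l' = set_coord (p k l) i0 (c i0).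
  move=> ll'; apply/rowP => i; rewrite !mxE ltnS leq_eqVlt.
  rewrite (_ : (val i == k) = (i == i0))//.
  case: eqVneq => [->|ii0] //=; case: ifP => // _.
  by case: ll' => ->//; rewrite ffunE (negPf ii0) addbF.
have pkE l' : (l' = l \/ l' = h l) ->
    p k l' = set_coord (p k l) i0 (if l' i0 then a i0 else b i0).
  move=> ll'; apply/rowP => i; rewrite !mxE.
  case: eqVneq => [->|ii0]; first by rewrite ltnn.
  by case: ifP => // _; case: ll' => ->//; rewrite ffunE (negPf ii0) addbF.
rewrite (pkE l); last by left.
rewrite (pkE (h l)); last by right.
rewrite (pk1 l); last by left.
rewrite (pk1 (h l)); last by right.
rewrite WE WhE ffunE eqxx addbT.
have := concave_in_each_variable_conv R n Omega (p k l) i0 (w i0) (a i0) (b i0)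
  Oc p0 (w01 i0) (a0 i0) (b0 i0).
move/(ler_wpM2r W'0); rewrite -/(c i0).
by case: (l i0) => /=; lra.
Qed.

(** * Upper bound on a block *)

Lemma class_C_dist (R : realType) (n : nat) (Omega f : 'rV[R]_n -> R)
    (x y : 'rV[R]_n) :
  class_C Omega f -> cube x -> cube y ->
  `|f x - f y| <= Omega (\row_i `|x 0 i - y 0 i|).
Proof.
move=> [_ fO] Dx Dy; rewrite -lee_fin.
apply: le_trans (fO (\row_i `|x 0 i - y 0 i|) _).
  by apply: ereal_sup_ubound; exists (x, y) => //=; split=> // i; rewrite mxE.
(* The distance vector is an admissible [tau]: points of the cube differ by at most one in each
   coordinate. *)
move=> i; rewrite mxE normr_ge0/= ler_norml.
by have := Dx i; have := Dy i; lra.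
Qed.

Lemma block_interpolant_error (R : realType) (n : nat)
    (Omega f : 'rV[R]_n -> R) (m j : 'I_n -> nat) (x : 'rV[R]_n) :
  MC_type Omega -> concave_in_each_variable Omega ->
  class_C Omega f -> (forall i, (j i < m i)%N) -> block m j x ->
  `|f x - block_interpolant m j f x| <=
  Omega (\row_i (1 / (2 * (m i)%:R))).
Proof.
move=> OMC Oc fC jm xj.
have mp i : 0 < (m i)%:R :> R by rewrite ltr0n; have := jm i; lia.
(* Distances to the right and left nodes; [w i] is the weight of the right one. *)
pose a i : R := (j i).+1%:R / (m i)%:R - x 0 i.
pose b i : R := x 0 i - (j i)%:R / (m i)%:R.
pose w i : R := (m i)%:R * b i.
have a0 i : 0 <= a i by have /andP[_] := xj i; rewrite /a subr_ge0.
have b0 i : 0 <= b i by have /andP[] := xj i; rewrite /b subr_ge0.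
have ab i : (m i)%:R * a i = 1 - w i.
  by rewrite /w /a /b -natr1; field; rewrite gt_eqF.
have w01 i : 0 <= w i <= 1.
  have := mulr_ge0 (ltW (mp i)) (a0 i); rewrite ab subr_ge0 => ->.
  by rewrite andbT mulr_ge0// ltW.
have HE l i : H l (m i) (j i) (x 0 i) = if l then w i else 1 - w i.
  by rewrite /H -/(a i) ab; case: l => //; rewrite opprB addrC subrK.
have nodeD k : (forall i, (k i <= m i)%N) -> cube (node R m k).
  move=> km i; rewrite mxE divr_ge0 ?ler0n//= ler_pdivrMr// mul1r ler_nat.
  exact: km.
have Dx : cube x.
  move=> i; have /andP[h1 h2] := xj i; apply/andP; split.
    by apply: le_trans h1; rewrite divr_ge0.
  by apply: (le_trans h2); rewrite ler_pdivrMr// mul1r ler_nat jm.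
pose W (l : {ffun 'I_n -> bool}) :=
  \prod_(i < n) (if l i then w i else 1 - w i).
have W0 l : 0 <= W l.
  apply: prodr_ge0 => i _; have /andP[w0 w1] := w01 i.
  by case: (l i) => //; rewrite subr_ge0.
pose v (l : {ffun 'I_n -> bool}) := node R m (fun i => (j i + l i)%N).
(* The weights sum to one, so [f x] can be moved under the sum. *)
have -> : f x - block_interpolant m j f x = \sum_l (f x - f (v l)) * W l.
  rewrite -[X in X - _]mulr1 -(sum_prod_bool R n w) mulr_sumr /block_interpolant.
  rewrite -sumrB; apply: eq_bigr => l _.
  rewrite mulrBl; congr (_ - _ * _).
  by apply: eq_bigr => i _; exact: HE.
apply: (le_trans (ler_norm_sum _ _ _)).
apply: le_trans (le_trans _ (multilinear_jensen R n Omega w a b Oc w01 a0 b0)) _.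
  apply: ler_sum => l _; rewrite normrM (ger0_norm (W0 l)) ler_wpM2r//.
  have -> : \row_i (if l i then a i else b i) = \row_i `|x 0 i - v l 0 i|.
    apply/rowP => i; rewrite !mxE; case: (l i) => /=.
      by rewrite addn1 -opprB -/(a i) normrN ger0_norm.
    by rewrite addn0 -/(b i) ger0_norm.
  apply: class_C_dist => //; apply: nodeD => i.
  by have := jm i; case: (l i) => /=; lia.
apply: (MC_nondecreasing OMC) => i; rewrite !mxE.
- have /andP[w0 w1] := w01 i.
  by apply: addr_ge0; apply: mulr_ge0; rewrite // subr_ge0.
- by rewrite divr_ge0// mulr_ge0// ltW.
- rewrite ler_pdivlMr; last by rewrite mulr_gt0.
  (* By [ab], both summands of the mean distance equal [w i * (1 - w i)] divided by [m i]. *)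
  have -> : (w i * a i + (1 - w i) * b i) * (2 * (m i)%:R) =
      4 * w i * (1 - w i) by rewrite -!ab {2}/w; rewrite /w; ring.
  by have := sqr_ge0 (2 * w i - 1); rewrite expr2; lra.
Qed.

(** * Tent functions and the extremal function *)

Definition tent (R : realType) (c t : R) : R := Num.max 0 (c - `|t - c|).

Lemma tent_ge0 (R : realType) (c t : R) : 0 <= tent R c t.
Proof. by rewrite /tent le_max lexx. Qed.

Lemma tent_dist (R : realType) (c s t : R) :
  `|tent R c s - tent R c t| <= `|s - t|.
Proof.
have key u v : tent R c u <= tent R c v + `|u - v|.
  rewrite /tent ge_max addr_ge0 ?le_max ?lexx//=.
  have : c - `|v - c| <= Num.max 0 (c - `|v - c|) by rewrite le_max lexx orbT.
  have := ler_distD u v c; rewrite [`|v - u|]distrC; lra.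
have := key s t; have := key t s; rewrite [`|t - s|]distrC ler_norml; lra.
Qed.

(** The nodes are the even multiples of the centre [c], so each is at distance at least [c] from
    it. *)
Lemma tent_node (R : realType) (m k : nat) :
  (0 < m)%N -> tent R (1 / (2 * m%:R)) (k%:R / m%:R) = 0.
Proof.
move=> m0; have mp : 0 < m%:R :> R by rewrite ltr0n.
set c := 1 / _; have c0 : 0 < c by rewrite divr_gt0// mulr_gt0.
have -> : k%:R / m%:R = 2 * k%:R * c by rewrite /c; field; rewrite gt_eqF.
apply/max_idPl; rewrite subr_le0; case: k => [|k].
  by rewrite mulr0 mul0r sub0r normrN ger0_norm// ltW.
apply: le_trans (ler_norm _); rewrite -[k.+1%:R]natr1.
have : 0 <= k%:R * c by rewrite mulr_ge0// ltW.
lra.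
Qed.

Definition tent_map (R : realType) (n : nat) (m : 'I_n -> nat)
    (x : 'rV[R]_n) : 'rV[R]_n :=
  \row_i tent R (1 / (2 * (m i)%:R)) (x 0 i).

Lemma tent_map_orthant (R : realType) (n : nat) (m : 'I_n -> nat)
    (x : 'rV[R]_n) : orthant (tent_map R n m x).
Proof. by move=> i; rewrite mxE tent_ge0. Qed.

Lemma tent_map_continuous (R : realType) (n : nat) (m : 'I_n -> nat) :
  continuous (tent_map R n m).
Proof.
move=> x; apply/(@cvg_ballP _ _ _ _ (nbhs_filter x)) => e e0.
apply: filterS (nbhsx_ballx x e e0) => y [_ xy]; split=> // i j.
have := xy i j; rewrite -!ball_normE /ball_/= !mxE; apply: le_lt_trans.
by rewrite !(ord1 i) tent_dist.
Qed.

(** Tents are 1-Lipschitz, so moving the point by at most [tau] raises each coordinate of [tent_map]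
    by at most that of [tau]; monotonicity and subadditivity of [Omega] then give the modulus
    bound. *)
Lemma MC_tent_class_C (R : realType) (n : nat) (Omega : 'rV[R]_n -> R)
    (m : 'I_n -> nat) :
  MC_type Omega -> class_C Omega (Omega \o tent_map R n m).
Proof.
move=> OMC; split.
  apply: continuous_subspaceT => x.
  (* [Omega] is continuous only within the orthant, but [tent_map] never leaves it. *)
  have /subspace_continuousP/(_ _ (tent_map_orthant R n m x)) :=
    MC_continuous OMC.
  apply: cvg_comp => A /=; rewrite /within/= => xA.
  have := tent_map_continuous R n m x _ xA; apply: (@filterS _ _ (nbhs_filter x)) => y /=.
  by apply; exact: tent_map_orthant.
move=> tau Dtau; apply: ge_ereal_sup => _ [[x y] /= [_ _ xy] <-].
rewrite lee_fin.
have tau0 : orthant tau by move=> i; have /andP[] := Dtau i.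
have key (u v : 'rV[R]_n) : (forall i, `|u 0 i - v 0 i| <= tau 0 i) ->
    Omega (tent_map R n m u) <= Omega (tent_map R n m v) + Omega tau.
  move=> uv.
  apply: le_trans (MC_subadditive OMC (tent_map_orthant R n m v) tau0).
  apply: (MC_nondecreasing OMC) (tent_map_orthant R n m u) _ _ => i.
    by rewrite mxE addr_ge0//; exact: tent_map_orthant.
  rewrite !mxE -lerBlDl; apply: le_trans (uv i).
  by apply: le_trans (tent_dist R _ _ _); exact: ler_norm.
have := key x y xy; have : Omega (tent_map R n m y) <=
    Omega (tent_map R n m x) + Omega tau.
  by apply: key => i; rewrite distrC.
by rewrite ler_norml; lra.
Qed.

Theorem theorem1 (R : realType) (n : nat) (n_ge1 : (1 <= n)%N)
    (Omega : 'rV[R]_n -> R) (Omega_MC : MC_type Omega)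
    (Omega_concave : concave_in_each_variable Omega)
    (m : 'I_n -> nat) (m_ge2 : forall i, (2 <= m i)%N) :
  interpolation_error m (class_C Omega) =
  (Omega (\row_i (1 / (2 * (m i)%:R))))%:E.
Proof.
have m0 i : (0 < m i)%N by exact: ltnW (m_ge2 i).
apply/le_anti/andP; split.
  apply: ge_ereal_sup => _ [f fC <-]; apply: ge_ereal_sup => _ [x Dx <-].
  rewrite lee_fin; have [jm xj] := block_indexP m0 Dx.
  exact: block_interpolant_error.
set c : 'rV[R]_n := \row_i _.
pose f := Omega \o tent_map R n m.
have Dc : cube c.
  move=> i; rewrite mxE divr_ge0 ?mulr_ge0//= ler_pdivrMr ?mulr_gt0 ?ltr0n//.
  by rewrite mul1r -natrM ler1n muln_gt0 m0.
(* Each tent peaks at its centre with height equal to the centre, so [tent_map] fixes [c]. *)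
have fc : f c = Omega c.
  congr Omega; apply/rowP => i; rewrite !mxE /tent subrr normr0 subr0.
  by apply/max_idPr; rewrite divr_ge0// mulr_ge0.
have Sc : spline m f c = 0.
  rewrite /spline /block_interpolant big1// => l _.
  rewrite [f _](_ : _ = 0) ?mul0r//= -(MC_zero Omega_MC) /f/=; congr Omega.
  by apply/rowP => i; rewrite !mxE tent_node.
apply: (@le_trans _ _ (deviation m f)); last first.
  by apply: ereal_sup_ubound; exists f => //; exact: MC_tent_class_C.
apply: (@le_trans _ _ `|f c - spline m f c|%:E).
  by rewrite lee_fin fc Sc subr0 ler_norm.
by apply: ereal_sup_ubound; exists c.
Qed.
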